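(* Let $(\mathcal E,\mathcal F)$ be a resistance form on a non-empty set $F$ (not assumed regular, and with $(F,R)$ not assumed separable or locally compact). The following statements are equivalent: (i) $(\mathcal E,\mathcal F)$ is recurrent; (ii) $1_F\in\mathcal F^{(1)}$, where $1_F$ is the constant function $1$; (iii) $\mathcal F=\mathcal F^{(1)}$.
   Context: **Resistance forms.** A pair $(\mathcal E,\mathcal F)$ is a resistance form on a non-empty set $F$ if: (RF1) $\mathcal F$ is a linear space of functions $F\to\mathbb R$ containing constants, $\mathcal E$ is a non-negative symmetric bilinear form on $\mathcal F$, and $\mathcal E(f,f)=0$ iff $f$ is constant; (RF2) $\mathcal F$ modulo constants is a Hilbert space under $\mathcal E$; (RF3) $\mathcal F$ separates points; (RF4) $R(x,y):=\sup\{|f(x)-f(y)|^2/\mathcal E(f,f):f\in\mathcal F,\mathcal E(f,f)>0\}<\infty$ for all $x,y$; (RF5) $\bar f=(f\wedge1)\vee0\in\mathcal F$ and $\mathcal E(\bar f,\bar f)\le\mathcal E(f,f)$ for $f\in\mathcal F$. Then $R$ is a metric (the resistance metric); $F$ carries the topology of $R$, and $\mathcal F\subseteq C(F,\mathbb R)$. For $A,B\subseteq F$, $R(A,B)=\bigl(\inf\{\mathcal E(f,f):f\in\mathcal F,f|_A=1,f|_B=0\}\bigr)^{-1}$ ($0$ if there is no such $f$; $\infty$ if the infimum is $0$); $R(x,B)=R(\{x\},B)$. **Recurrence.** $(\mathcal E,\mathcal F)$ is recurrent if there is an increasing sequence $(U_n)_{n\ge1}$ of relatively compact open subsets of $F$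 with $\bigcup_nU_n=F$ and $\lim_{n\to\infty}R(\rho,U_n^c)=\infty$ for some $\rho\in F$. **The space $\mathcal F^{(1)}$.** Fix $x_0\in F$ and set $\mathcal E^{(1)}(u,v)=\mathcal E(u,v)+u(x_0)v(x_0)$, an inner product on $\mathcal F$. $\mathcal F^{(1)}$ is the closure of $C_c(F,\mathbb R)\cap\mathcal F$ in $(\mathcal F,\mathcal E^{(1)})$, where $C_c(F,\mathbb R)$ is the space of compactly supported continuous functions; it does not depend on $x_0$. *)

(* Defs.v *)
From HB Require Import structures.
From mathcomp Require Import all_boot all_order all_algebra ring lra.
From mathcomp Require Import all_classical all_reals all_analysis.

Set Implicit Arguments.
Unset Strict Implicit.
Unset Printing Implicit Defensive.

Import Order.TTheory GRing.Theory Num.Theory.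
Import numFieldNormedType.Exports.
Local Open Scope classical_set_scope.
Local Open Scope ring_scope.

(* The energy is a total function, but only its values on the domain are
   constrained or used.
   [rf_complete] says that the domain modulo constants is a Hilbert space,
   written on representatives: the energy of a difference of functions is the
   squared distance of their classes, so a limit f is unique up to a constant.
   In [rf_bounded], finiteness of the supremum defining the resistance is
   boundedness of the set.
   F is not required to be non-empty here: a point of F is a parameter
   of [dom1] below. *)
Record resistance_form (R : realType) (F : Type) := ResistanceForm {
  rf_dom : set (F -> R) ;
  rf_energy : (F -> R) -> (F -> R) -> R ;
  rf_dom_cst : forall c, rf_dom (cst c) ;
  rf_dom_lin : forall a f g, rf_dom f -> rf_dom g ->
    rf_dom (fun x => a * f x + g x) ;
  rf_energy_lin : forall a f g h, rf_dom f -> rf_dom g -> rf_dom h ->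
    rf_energy (fun x => a * f x + g x) h = a * rf_energy f h + rf_energy g h ;
  rf_energy_sym : forall f g, rf_dom f -> rf_dom g ->
    rf_energy f g = rf_energy g f ;
  rf_energy_ge0 : forall f, rf_dom f -> 0 <= rf_energy f f ;
  rf_energy_eq0 : forall f, rf_dom f ->
    rf_energy f f = 0 <-> exists c, f = cst c ;
  rf_complete : forall u : nat -> F -> R, (forall n, rf_dom (u n)) ->
    (forall e : R, 0 < e -> exists N, forall m n, (N <= m)%N -> (N <= n)%N ->
       rf_energy (u m \- u n) (u m \- u n) < e) ->
    exists2 f, rf_dom f &
      rf_energy (u n \- f) (u n \- f) @[n --> \oo] --> (0 : R) ;
  rf_separates : forall x y, x <> y -> exists2 f, rf_dom f & f x <> f y ;
  rf_bounded : forall x y, has_ubound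
    [set `|f x - f y| ^+ 2 / rf_energy f f |
      f in [set f | rf_dom f /\ 0 < rf_energy f f]] ;
  rf_markov : forall f, rf_dom f ->
    rf_dom (fun x => Num.max (Num.min (f x) 1) 0) /\
    rf_energy (fun x => Num.max (Num.min (f x) 1) 0)
              (fun x => Num.max (Num.min (f x) 1) 0) <= rf_energy f f
}.

(* [sup set0 = 0]: this is the value of the resistance when F is a single
   point, where no function has positive energy. *)
Definition resistance (R : realType) (F : Type) (E : resistance_form R F)
    (x y : F) : R :=
  sup [set `|f x - f y| ^+ 2 / rf_energy E f f |
        f in [set f | rf_dom E f /\ 0 < rf_energy E f f]].

Section ResistanceMetric.
Context {R : realType} {F : Type} (E : resistance_form R F).
Implicit Types (f g h : F -> R) (x y z : F).
Local Notation D := (rf_dom E).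
Local Notation EE := (rf_energy E).

Lemma rf_dom_affine a c f : D f -> D (fun x => a * f x + c).
Proof. by move=> Df; exact: (rf_dom_lin a Df (rf_dom_cst E c)). Qed.

Lemma rf_energy_expand a f g : D f -> D g ->
  EE (fun x => a * f x + g x) (fun x => a * f x + g x) =
  a ^+ 2 * EE f f + 2 * a * EE f g + EE g g.
Proof.
move=> Df Dg; have Dh := rf_dom_lin a Df Dg.
rewrite rf_energy_lin// (rf_energy_sym Df Dh) (rf_energy_sym Dg Dh).
rewrite !rf_energy_lin// (rf_energy_sym Dg Df); ring.
Qed.

Lemma rf_energy_cst c f : D f -> EE (cst c) f = 0.
Proof.
move=> Df; have Dc := rf_dom_cst E c.
have Ec : EE (cst c) (cst c) = 0 by apply/rf_energy_eq0 => //; exists c.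
have H a : 0 <= 2 * a * EE (cst c) f + EE f f.
  have := rf_energy_ge0 (rf_dom_lin a Dc Df).
  by rewrite rf_energy_expand// Ec mulr0 add0r.
apply/eqP; apply: contraT => b0.
have := H (- (EE f f + 1) / (2 * EE (cst c) f)).
have -> : 2 * (- (EE f f + 1) / (2 * EE (cst c) f)) * EE (cst c) f
  = - (EE f f + 1) by field.
lra.
Qed.

Lemma rf_energy_affine a c f : D f ->
  EE (fun x => a * f x + c) (fun x => a * f x + c) = a ^+ 2 * EE f f.
Proof.
move=> Df; rewrite (rf_energy_expand a Df (rf_dom_cst E c)).
rewrite (rf_energy_sym Df (rf_dom_cst E c)) !rf_energy_cst//; last exact: rf_dom_cst.
ring.
Qed.

Lemma resistance_ge0 x y : 0 <= resistance E x y.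
Proof.
rewrite /resistance; set A := (X in sup X).
have [->|/set0P[q Aq]] := eqVneq A set0; first by rewrite sup0.
apply: (le_trans _ (ub_le_sup (rf_bounded E x y) Aq)).
by case: Aq => f [_ Ef] <-; rewrite divr_ge0 ?sqr_ge0 ?ltW.
Qed.

Lemma le_resistance f x y : D f ->
  `|f x - f y| ^+ 2 <= resistance E x y * EE f f.
Proof.
move=> Df; have := rf_energy_ge0 Df; rewrite le_eqVlt => /predU1P[/esym Ef0|Ef].
  have [c ->] := (rf_energy_eq0 Df).1 Ef0.
  rewrite /cst subrr normr0 expr0n/=.
  by rewrite mulr_ge0 ?resistance_ge0// rf_energy_ge0//; exact: rf_dom_cst.
by rewrite -ler_pdivrMr//; apply: ub_le_sup; [exact: rf_bounded|exists f].
Qed.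

Lemma resistance_le x y r : 0 <= r ->
  (forall f, D f -> 0 < EE f f -> `|f x - f y| ^+ 2 <= r * EE f f) ->
  resistance E x y <= r.
Proof.
move=> r0 H; rewrite /resistance; set A := (X in sup X).
have [->|/set0P A0] := eqVneq A set0; first by rewrite sup0.
by apply: ge_sup => // _ [f [Df Ef] <-]; rewrite ler_pdivrMr//; exact: H.
Qed.

Lemma resistancexx x : resistance E x x = 0.
Proof.
apply/eqP; rewrite eq_le resistance_ge0 andbT; apply: resistance_le => // f _ _.
by rewrite subrr normr0 expr0n/= mul0r.
Qed.

Lemma resistance_eq0 x y : resistance E x y = 0 -> x = y.
Proof.
move=> Rxy; apply: contrapT => /(rf_separates E)[f Df]; apply.
have := le_resistance x y Df; rewrite Rxy mul0r => fxy.
apply/eqP; rewrite -subr_eq0 -normr_eq0 -sqrf_eq0 eq_le fxy.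
by rewrite sqr_ge0.
Qed.

Lemma resistance_sym x y : resistance E x y = resistance E y x.
Proof.
by rewrite /resistance; congr sup; apply: eq_imagel => f _; rewrite distrC.
Qed.

(* The cut of g at level t does not increase the energy, also after adding
   multiples of the part of g above t; hence the two parts have
   non-negative mutual energy. *)
Lemma rf_energy_cut g t : D g -> (forall x, 0 <= g x) -> 0 < t ->
  let u := fun x => Num.min (g x) t in
  let v := fun x => g x - Num.min (g x) t in
  [/\ D u, D v & EE u u + EE v v <= EE g g].
Proof.
move=> Dg g0 t0 u v.
have cutE h x : 0 <= h x ->
    Num.min (h x) t = t * Num.max (Num.min (t^-1 * h x + 0) 1) 0 + 0.
  move=> hx; rewrite !addr0 max_l; last first.
    by rewrite le_min ler01 andbT mulr_ge0// invr_ge0 ltW.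
  have := minr_pMr (t^-1 * h x) 1 (ltW t0).
  by rewrite mulr1 mulVKf ?gt_eqF.
have cut h : D h -> (forall x, 0 <= h x) ->
    D (fun x => Num.min (h x) t) /\
    EE (fun x => Num.min (h x) t) (fun x => Num.min (h x) t) <= EE h h.
  move=> Dh h0.
  have -> : (fun x => Num.min (h x) t) =
    (fun x => t * Num.max (Num.min (t^-1 * h x + 0) 1) 0 + 0).
    by apply/funext => x; exact: cutE.
  have [Dk Ek] := rf_markov (rf_dom_affine t^-1 0 Dh).
  split; first exact: (rf_dom_affine t 0 Dk).
  rewrite (rf_energy_affine t 0 Dk).
  move: Ek; rewrite (rf_energy_affine t^-1 0 Dh) => Ek.
  apply: (le_trans (ler_wpM2l (sqr_ge0 t) Ek)).
  by rewrite mulrA -exprMn divff ?gt_eqF// expr1n mul1r.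
have [Du _] := cut g Dg g0.
have Dv : D v.
  have -> : v = (fun x => -1 * u x + g x).
    by apply/funext => x; rewrite /v /u mulN1r addrC.
  exact: rf_dom_lin.
split=> //.
have gE : g = (fun x => 1 * v x + u x).
  by apply/funext => x; rewrite /v /u mul1r subrK.
have v0 x : 0 <= v x by rewrite /v subr_ge0 ge_min lexx.
have u0 x : 0 <= u x by rewrite /u le_min g0 ltW.
have H s : 0 < s -> 0 <= s ^+ 2 * EE v v + 2 * s * EE v u.
  move=> s0; have Dw := rf_dom_lin s Dv Du.
  have w0 x : 0 <= s * v x + u x by rewrite addr_ge0// mulr_ge0// ltW.
  have [_] := cut _ Dw w0.
  have -> : (fun x => Num.min (s * v x + u x) t) = u.
    apply/funext => x; rewrite /v /u.
    case: (leP (g x) t) => gt; first by rewrite subrr mulr0 add0r min_l.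
    by rewrite min_r// lerDr mulr_ge0 ?(ltW s0)// subr_ge0 ltW.
  rewrite rf_energy_expand//; lra.
rewrite [leRHS](_ : _ = EE (fun x => 1 * v x + u x) (fun x => 1 * v x + u x));
  last by rewrite -gE.
rewrite rf_energy_expand// expr1n mul1r mulr1 addrC.
suff : 0 <= EE v u by lra.
rewrite leNgt; apply/negP => b0; have q0 := rf_energy_ge0 Dv.
have s0 : 0 < - EE v u / (EE v v + 1) by rewrite divr_gt0//; lra.
have := H _ s0; set s := _ / _ in s0 *.
have sE : s * (EE v v + 1) = - EE v u by rewrite /s divfK// gt_eqF//; lra.
rewrite leNgt => /negP; apply; nra.
Qed.

Lemma resistance_triangle y x z :
  resistance E x z <= resistance E x y + resistance E y z.
Proof.
set a := resistance E x y; set b := resistance E y z.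
have a0 : 0 <= a := resistance_ge0 _ _; have b0 : 0 <= b := resistance_ge0 _ _.
suff H g : D g -> (forall w, 0 <= g w <= 1) -> g x = 1 -> g z = 0 ->
    1 <= (a + b) * EE g g.
  apply: resistance_le => [|f Df Ef]; first exact: addr_ge0.
  have [->|fxz] := eqVneq (f x) (f z).
    by rewrite subrr normr0 expr0n/= mulr_ge0 ?addr_ge0// ltW.
  have d0 : f x - f z != 0 by rewrite subr_eq0.
  pose c := (f x - f z)^-1.
  have [Dg Eg] := rf_markov (rf_dom_affine c (- (c * f z)) Df).
  have := H _ Dg.
  rewrite -mulrBr mulVf// subrr minxx max_l// min_l// maxxx.
  have rng w : 0 <= Num.max (Num.min (c * f w - c * f z) 1) 0 <= 1.
    by rewrite le_max lexx orbT ge_max ge_min lexx orbT ler01.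
  move=> /(_ rng erefl erefl) /le_trans H1.
  have := H1 _ (ler_wpM2l (addr_ge0 a0 b0) Eg).
  rewrite (rf_energy_affine _ _ Df) /c exprVn real_normK ?num_real//.
  by rewrite mulrCA ler_pdivlMl ?mulr1// exprn_even_gt0.
move=> Dg g01 gx gz.
have g0 w : 0 <= g w by case/andP: (g01 w).
have /andP[] := g01 y; rewrite le_eqVlt => /predU1P[gy _|t0 t1].
  have := le_resistance x y Dg; rewrite -gy gx subr0 normr1 expr1n -/a => H1.
  by rewrite mulrDl (le_trans H1)// lerDl mulr_ge0// rf_energy_ge0.
have [Du Dv Euv] := rf_energy_cut Dg g0 t0.
have := le_resistance y z Du; have := le_resistance x y Dv.
move: Euv (rf_energy_ge0 Du) (rf_energy_ge0 Dv); rewrite -/a -/b.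
rewrite minxx gx gz (min_r t1) (min_l (ltW t0)) subrr !subr0.
rewrite !real_normK ?num_real//.
set p := EE _ _; set q := EE _ _; set e := EE g g; set t := g y in t0 t1 *.
move=> pqe p0 q0 H1 H2.
apply: (@le_trans _ _ ((a + b) * (p + q))); last first.
  by rewrite ler_wpM2l// addr_ge0.
have K : 2 * (t * (1 - t)) <= a * p + b * q.
  rewrite -(@ler_pXn2r _ 2)// ?nnegrE; last 2 first.
  - by rewrite !mulr_ge0 ?subr_ge0 ?(ltW t0).
  - by rewrite addr_ge0// mulr_ge0.
  have := ler_pM (sqr_ge0 _) (sqr_ge0 _) H1 H2.
  have := sqr_ge0 (a * p - b * q); lra.
lra.
Qed.

End ResistanceMetric.

(* The set F with the metric, hence the topology, of the resistance. *)
Definition resistance_space (R : realType) (F : Type)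
  (E : resistance_form R F) : Type := F.

Section ResistanceSpace.
Context {R : realType} {F : Type} (E : resistance_form R F).
Local Notation X := (resistance_space E).

HB.instance Definition _ := gen_eqMixin X.
HB.instance Definition _ := gen_choiceMixin X.
HB.instance Definition _ := @isMetric.Build R X (resistance E)
  (resistancexx E) (@resistance_eq0 R F E) (resistance_sym E)
  (resistance_triangle E).

(* In [\bar R], [ereal_inf set0 = +oo], [+oo^-1 = 0] and [0^-1 = +oo]. *)
Definition set_resistance (A B : set X) : \bar R :=
  ((ereal_inf [set (rf_energy E f f)%:E | f in
      [set f | [/\ rf_dom E f, (forall x, A x -> f x = 1%R) &
                               (forall x, B x -> f x = 0%R)]]])^-1)%E.

Definition recurrent : Prop :=
  exists U : nat -> set X,
    [/\ (forall n, U n `<=` U n.+1),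
        (forall n, open (U n) /\ precompact (U n)),
        \bigcup_n U n = setT &
        exists rho : X,
          set_resistance [set rho] (~` U n) @[n --> \oo] --> +oo%E].

Definition Cc : set (X -> R) :=
  [set f | continuous f /\ compact (closure [set x | f x != 0])].

Definition energy1 (x0 : X) (u v : X -> R) : R :=
  rf_energy E u v + u x0 * v x0.

(* The closure of [Cc `&` rf_dom E] in [rf_dom E] for the norm of
   [energy1 x0]. *)
Definition dom1 (x0 : X) : set (X -> R) :=
  [set f | rf_dom E f /\
    forall e : R, 0 < e -> exists2 g, (Cc `&` rf_dom E) g &
      Num.sqrt (energy1 x0 (f \- g) (f \- g)) < e].

End ResistanceSpace.

Arguments Cc {R F} E.
Arguments recurrent {R F} E.
Arguments dom1 {R F} E x0.

(* Main.v *)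
(** (i) => (ii): a function equal to 1 at rho and to 0 off a relatively compact
    U_n, of small energy, is compactly supported and close to 1.
    (ii) => (iii): given f in the domain and compactly supported h close to 1,
    the truncation of f between -M h and M h is compactly supported, close
    to f on a large ball, and its energy is bounded independently of h and M.
    Bounded energy and pointwise convergence only give weak convergence; norm
    convergence is recovered by minimizing the energy over the convex sets of
    compactly supported functions close to f on larger and larger balls.
    (iii) => (i): if h_n is compactly supported with h_n -> 1, the sets
    {h_0 > 1/2} U ... U {h_n > 1/2} exhaust the space. *)

Require Import Defs.
From mathcomp Require Import all_boot all_order all_algebra ring lra.
From mathcomp Require Import all_classical all_reals all_analysis.
Import Order.TTheory GRing.Theory Num.Theory.
Import numFieldNormedType.Exports.
Local Open Scope classical_set_scope.
Local Open Scope ring_scope.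

(** * Energy bounds for truncations and minima *)

Section Energy.
Set Implicit Arguments.
Unset Strict Implicit.
Context {R : realType} {F : Type} (E : resistance_form R F).
Implicit Types (f g h : F -> R) (x y : F).
Local Notation D := (rf_dom E).
Local Notation EE := (rf_energy E).

(** The energies of [a f + g] and [- a f + g] add up to the right-hand side, and the second one is
    non-negative. *)
Lemma rf_energy_lin_le a f g : D f -> D g ->
  EE (fun x => a * f x + g x) (fun x => a * f x + g x) <=
  2 * a ^+ 2 * EE f f + 2 * EE g g.
Proof.
move=> Df Dg; have := rf_energy_ge0 (rf_dom_lin (- a) Df Dg).
rewrite !rf_energy_expand// sqrrN; lra.
Qed.

Lemma rf_subE f g : f \- g = (fun x => -1 * g x + f x).
Proof. by apply/funext => x /=; rewrite mulN1r addrC. Qed.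

Lemma rf_dom_sub f g : D f -> D g -> D (f \- g).
Proof. by rewrite rf_subE => Df Dg; exact: rf_dom_lin. Qed.

Lemma rf_midE f g :
  (fun x => (f x + g x) / 2) = (fun x => 2^-1 * (1 * f x + g x) + 0).
Proof. by apply/funext => x; rewrite mul1r addr0 mulrC. Qed.

Lemma rf_dom_mid f g : D f -> D g -> D (fun x => (f x + g x) / 2).
Proof. by move=> Df Dg; rewrite rf_midE; exact/rf_dom_affine/rf_dom_lin. Qed.

Lemma rf_parallelogram f g : D f -> D g ->
  EE (f \- g) (f \- g) = 2 * EE f f + 2 * EE g g
    - 4 * EE (fun x => (f x + g x) / 2) (fun x => (f x + g x) / 2).
Proof.
move=> Df Dg; rewrite rf_midE (rf_energy_affine 2^-1 0 (rf_dom_lin 1 Df Dg)).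
rewrite rf_subE !rf_energy_expand// (rf_energy_sym Df Dg).
by field.
Qed.

(** After division by a level [t >= M] the upper cut in the Markov property is inactive; the scaling
    factors cancel in the energy, so [M] leaves no trace in the bound. *)
Lemma rf_dom_pos f M : D f -> (forall x, f x <= M) ->
  D (fun x => Num.max (f x) 0) /\
  EE (fun x => Num.max (f x) 0) (fun x => Num.max (f x) 0) <= EE f f.
Proof.
move=> Df fM; pose t := Num.max M 1.
have t0 : 0 < t by rewrite lt_max ltr01 orbT.
have -> : (fun x => Num.max (f x) 0) =
    (fun x => t * Num.max (Num.min (t^-1 * f x + 0) 1) 0 + 0).
  apply/funext => x; rewrite !addr0 min_l; last first.
    by rewrite ler_pdivrMl// mulr1 le_max fM.
  by rewrite maxr_pMr ?ltW// mulr0 mulVKf ?gt_eqF.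
have [Dk Ek] := rf_markov (rf_dom_affine t^-1 0 Df).
split; first exact: rf_dom_affine.
move: Ek; rewrite !rf_energy_affine// -(ler_pM2l (exprn_gt0 2 t0)) => Ek.
by rewrite (le_trans Ek)// mulrA -exprMn divff ?gt_eqF// expr1n mul1r.
Qed.

(** The minimum is [f] minus the positive part of [f - g]. Bounding the energy of each of the two
    differences gives 2(2E(f) + 2E(g)) + 2E(f). *)
Lemma rf_dom_min f g M : D f -> D g -> (forall x, f x - g x <= M) ->
  D (fun x => Num.min (f x) (g x)) /\
  EE (fun x => Num.min (f x) (g x)) (fun x => Num.min (f x) (g x)) <=
  6 * EE f f + 4 * EE g g.
Proof.
move=> Df Dg fgM; have [|Dp Ep] := @rf_dom_pos (f \- g) M (rf_dom_sub Df Dg).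
  exact: fgM.
have -> : (fun x => Num.min (f x) (g x)) =
    (fun x => -1 * Num.max ((f \- g) x) 0 + f x).
  apply/funext => x /=; rewrite mulN1r; case: (leP (f x) (g x)) => fg.
    by rewrite max_r ?subr_le0// oppr0 add0r.
  by rewrite max_l ?subr_ge0 1?ltW// opprB subrK.
split; first exact: rf_dom_lin.
apply: (le_trans (rf_energy_lin_le (-1) Dp Df)).
move: Ep; rewrite rf_subE => Ep.
have := rf_energy_lin_le (-1) Dg Df; lra.
Qed.

(** An affine map carries [-M, M] onto [0, 1], where the truncation becomes the Markov cut. *)
Lemma rf_dom_trunc f M : 0 < M -> D f ->
  D (fun x => Num.max (Num.min (f x) M) (- M)) /\
  EE (fun x => Num.max (Num.min (f x) M) (- M))
     (fun x => Num.max (Num.min (f x) M) (- M)) <= EE f f.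
Proof.
move=> M0 Df; pose t := 2 * M; have t0 : 0 < t by rewrite mulr_gt0.
have -> : (fun x => Num.max (Num.min (f x) M) (- M)) =
    (fun x => t * Num.max (Num.min (t^-1 * f x + 2^-1) 1) 0 + - M).
  apply/funext => x; rewrite maxr_pMr ?ltW// minr_pMr ?ltW// mulr0 mulr1.
  have -> : t * (t^-1 * f x + 2^-1) = f x + M.
    by rewrite mulrDr mulVKf ?gt_eqF// /t; field.
  have -> : t = M + M by rewrite /t mulr_natl mulr2n.
  by rewrite -addr_minl addr_maxl addrK add0r.
have [Dk Ek] := rf_markov (rf_dom_affine t^-1 2^-1 Df).
split; first exact: rf_dom_affine.
move: Ek; rewrite !rf_energy_affine// -(ler_pM2l (exprn_gt0 2 t0)) => Ek.
by rewrite (le_trans Ek)// mulrA -exprMn divff ?gt_eqF// expr1n mul1r.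
Qed.

(** Two minima with [M * h], separated by a sign change, give 6(6E(f) + 4M^2 E(h)) + 4M^2 E(h). The
    result vanishes wherever [h] does, and [C] does not enter the bound. *)
Lemma rf_dom_clamp f h M C : D f -> D h -> 0 < M ->
  (forall x, `|f x| <= C) -> (forall x, 0 <= h x) ->
  D (fun x => Num.max (Num.min (f x) (M * h x)) (- (M * h x))) /\
  EE (fun x => Num.max (Num.min (f x) (M * h x)) (- (M * h x)))
     (fun x => Num.max (Num.min (f x) (M * h x)) (- (M * h x))) <=
  36 * EE f f + 28 * M ^+ 2 * EE h h.
Proof.
move=> Df Dh M0 fC h0.
have Dk := rf_dom_affine M 0 Dh; have Ek := rf_energy_affine M 0 Dh.
set k := (fun x => M * h x + 0) in Dk Ek.
have k0 x : 0 <= k x by rewrite /k addr0 mulr_ge0// ltW.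
have [|Du Eu] := @rf_dom_min f k C Df Dk.
  by move=> x; have := ler_norm (f x); have := fC x; have := k0 x; lra.
have Dv := rf_dom_affine (-1) 0 Du; have Ev := rf_energy_affine (-1) 0 Du.
set v := (fun x => -1 * Num.min (f x) (k x) + 0) in Dv Ev.
have [|Dw Ew] := @rf_dom_min v k C Dv Dk.
  move=> x; have := fC x; have := k0 x; rewrite ler_norml => ? /andP[? ?].
  by rewrite /v; case: (leP (f x) (k x)); lra.
have -> : (fun x => Num.max (Num.min (f x) (M * h x)) (- (M * h x))) =
    (fun x => -1 * Num.min (v x) (k x) + 0).
  by apply/funext => x; rewrite /v /k !addr0 !mulN1r oppr_min opprK.
split; first exact: rf_dom_affine.
move: Ew; rewrite (rf_energy_affine _ _ Dw) Ev Ek; move: Eu; rewrite Ek.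
lra.
Qed.

End Energy.

(** * Strong approximation from decreasing convex sets *)

Section Mazur.
Set Implicit Arguments.
Unset Strict Implicit.
Context {R : realType} {F : Type} (E : resistance_form R F).
Implicit Types (f g h : F -> R) (x y : F).
Local Notation D := (rf_dom E).
Local Notation EE := (rf_energy E).

(* Choose k_n in K n whose energy is within 1/(n+1) of the infimum d_n over
   K n. As d_n is nondecreasing and bounded, the parallelogram identity makes
   k_n a Cauchy sequence, and its limit differs from f by a constant. *)
Lemma rf_convex_approx (K : nat -> set (F -> R)) B f :
  D f -> (forall n, K n `<=` D) ->
  (forall m n, (m <= n)%N -> K n `<=` K m) ->
  (forall n g h, K n g -> K n h -> K n (fun x => (g x + h x) / 2)) ->
  (forall n, exists2 g, K n g & EE g g <= B) ->
  (forall x (e : R), 0 < e -> exists n, forall g, K n g -> `|g x - f x| <= e) ->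
  forall n (e : R), 0 < e -> exists2 g, K n g & EE (f \- g) (f \- g) < e.
Proof.
move=> Df KD Kdec Kmid KB Kf.
pose S n := [set EE g g | g in K n].
have S0 n : has_inf (S n).
  split; first by have [g Kg _] := KB n; exists (EE g g), g.
  by exists 0 => _ [g Kg <-]; apply: rf_energy_ge0; exact: KD Kg.
pose d n := inf (S n).
have dle n g : K n g -> d n <= EE g g.
  by move=> Kg; apply: ge_inf; [case: (S0 n) | exists g].
have dB : has_sup (range d).
  split; first by exists (d 0%N), 0%N.
  by exists B => _ [n _ <-]; have [g Kg] := KB n; apply/le_trans/dle.
have dL n : d n <= sup (range d) by apply: ub_le_sup; [case: dB | exists n].
have /choice[k kP] n : exists g, K n g /\ EE g g < d n + n.+1%:R^-1.
  have n0 : 0 < n.+1%:R^-1 :> R by rewrite invr_gt0 ltr0n.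
  by have [_ [g Kg <-] ?] := inf_adherent n0 (S0 n); exists g.
have Dk n : D (k n) by apply: KD; case: (kP n) => Kk _; exact: Kk.
have kC (e : R) : 0 < e -> exists N, forall m n, (N <= m)%N -> (N <= n)%N ->
    EE (k m \- k n) (k m \- k n) < e.
  (* With L the supremum of [d], both energies are below L + e/8 and that of the midpoint, which
     lies in [K N1], is above L - e/8; the parallelogram identity then leaves less than 4(e/8) +
     4(e/8) = e. *)
  move=> e0; have e8 : 0 < e / 8 by rewrite divr_gt0.
  have [_ [N1 _ <-] LN] := sup_adherent e8 dB.
  pose N2 := Num.truncn (e / 8)^-1.
  have N2P n : (N2 <= n)%N -> n.+1%:R^-1 < e / 8.
    move=> Nn; rewrite invf_plt ?posrE ?ltr0n//.
    by rewrite (lt_le_trans (truncnS_gt _))// ler_nat.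
  exists (maxn N1 N2) => m n; rewrite !geq_max => /andP[m1 m2] /andP[n1 n2].
  have [[Km km] [Kn kn]] := (kP m, kP n).
  have := dle _ _ (Kmid _ _ _ (Kdec _ _ m1 _ Km) (Kdec _ _ n1 _ Kn)).
  rewrite rf_parallelogram//.
  have := N2P _ m2; have := N2P _ n2; have := dL m; have := dL n.
  move: km kn LN; set L := sup _; set em := EE (k m) _; set en := EE (k n) _.
  set ed := EE _ _; set dm := d m; set dn := d n; set d1 := d N1.
  set im := m.+1%:R^-1; set in_ := n.+1%:R^-1; lra.
have [l Dl kl] := rf_complete Dk kC.
have {}kl (e : R) : 0 < e -> exists N, forall n, (N <= n)%N ->
    EE (k n \- l) (k n \- l) < e.
  move=> e0; have /cvgrPdist_lt/(_ e e0)[N _ NP] := kl.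
  exists N => n /NP /=; rewrite sub0r normrN ger0_norm//.
  by apply: rf_energy_ge0; exact: rf_dom_sub.
(* The increments of [k n] between two points converge to those of [f] by [Kf], and to those of [l]
   by the resistance estimate. *)
have fl x y : f x - l x = f y - l y.
  apply/eqP; rewrite -subr_eq0 -normr_eq0 eq_le normr_ge0 andbT.
  apply/ler_addgt0Pl => e e0; rewrite addr0.
  have e3 : 0 < e / 3 by rewrite divr_gt0.
  have [Nx NxP] := Kf x _ e3; have [Ny NyP] := Kf y _ e3.
  have r1 : 0 < resistance E x y + 1 by rewrite ltr_wpDl ?resistance_ge0.
  have c0 : 0 < (e / 3) ^+ 2 / (resistance E x y + 1).
    by rewrite divr_gt0 ?exprn_gt0.
  have [Nl NlP] := kl _ c0.
  pose n := maxn Nl (maxn Nx Ny).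
  have nl : (Nl <= n)%N by rewrite leq_maxl.
  have nx : (Nx <= n)%N by rewrite /n maxnCA leq_maxl.
  have ny : (Ny <= n)%N by rewrite /n maxnA leq_maxr.
  have [Kn _] := kP n.
  have := NxP _ (Kdec _ _ nx _ Kn); have := NyP _ (Kdec _ _ ny _ Kn).
  have : `|(k n \- l) x - (k n \- l) y| <= e / 3.
    rewrite -(@ler_pXn2r _ 2)// ?nnegrE ?(ltW e3)//.
    apply: (le_trans (le_resistance _ _ (rf_dom_sub (Dk n) Dl))).
    move: (NlP _ nl); rewrite ltr_pdivlMr// => H.
    have := rf_energy_ge0 (rf_dom_sub (Dk n) Dl); lra.
  rewrite /= !ler_norml => /andP[? ?] /andP[? ?] /andP[? ?].
  by apply/andP; split; lra.
move=> n e e0; have [N NP] := kl _ e0.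
exists (k (maxn n N)).
  by apply: (Kdec _ _ (leq_maxl n N)); case: (kP (maxn n N)).
have := NP _ (leq_maxr n N).
(* A point is needed to name the constant [f - l]; on an empty [F] all functions coincide. *)
set m := maxn n N; case: (pselect (inhabited F)) => [[x]|F0].
  have -> : f \- k m = (fun y => -1 * (k m \- l) y + (f x - l x)).
    by apply/funext => y /=; rewrite (fl x y); ring.
  by rewrite rf_energy_affine ?sqrrN ?expr1n ?mul1r//; exact: rf_dom_sub.
by have -> : f \- k m = k m \- l by apply/funext => x; case: F0.
Qed.

End Mazur.

(** * Continuity, compact supports and resistance between sets *)

Section Topology.
Set Implicit Arguments.
Unset Strict Implicit.
Context {R : realType} {F : Type} (E : resistance_form R F).
Local Notation X := (resistance_space E).
Implicit Types (f g h : X -> R) (x y : X).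
Local Notation D := (rf_dom E).
Local Notation EE := (rf_energy E).

Lemma rf_dom_continuous f : D f -> continuous f.
Proof.
move=> Df x; apply/(@cvgrPdist_lt _ _ _ _ (nbhs_filter x)) => e e0.
have c0 : 0 < e ^+ 2 / (EE f f + 1).
  by rewrite divr_gt0 ?exprn_gt0 ?ltr_wpDl ?rf_energy_ge0.
apply: filterS (nbhsx_ballx x _ c0) => y xy.
rewrite -(@ltr_pXn2r _ 2)// ?nnegrE ?(ltW e0)//.
apply: (le_lt_trans (le_resistance x y Df)).
have : resistance E x y < e ^+ 2 / (EE f f + 1) := xy.
rewrite ltr_pdivlMr ?ltr_wpDl ?rf_energy_ge0// => H.
have := resistance_ge0 E x y; lra.
Qed.

Lemma energy1_ge0 x f : D f -> 0 <= energy1 x f f.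
Proof. by move=> Df; rewrite addr_ge0 ?rf_energy_ge0// -expr2 sqr_ge0. Qed.

Lemma energy1_cst1 x f : D f ->
  energy1 x (cst 1 \- f) (cst 1 \- f) = EE f f + (1 - f x) ^+ 2.
Proof.
move=> Df; rewrite /energy1 -expr2; congr (_ + _).
have -> : cst 1 \- f = (fun y => -1 * f y + 1) by rewrite rf_subE.
by rewrite rf_energy_affine// sqrrN expr1n mul1r.
Qed.

(** From f(x)^2 <= 2(f(x) - f(x0))^2 + 2f(x0)^2. Hence convergence for [energy1] is uniform on
    resistance balls. *)
Lemma sqr_le_energy1 x0 x f : D f ->
  f x ^+ 2 <= 2 * (1 + resistance E x x0) * energy1 x0 f f.
Proof.
move=> Df; have := le_resistance x x0 Df; rewrite real_normK ?num_real//.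
rewrite /energy1; have := rf_energy_ge0 Df; have := resistance_ge0 E x x0.
set r := resistance _ _ _; set e := EE f f => r0 e0 H.
have := mulr_ge0 r0 (sqr_ge0 (f x0)).
have := sqr_ge0 (f x - 2 * f x0); lra.
Qed.

Lemma dom1P x0 f : dom1 E x0 f <->
  D f /\ forall e : R, 0 < e -> exists2 g, (Cc E `&` D) g &
    energy1 x0 (f \- g) (f \- g) < e.
Proof.
split=> -[Df H]; split=> // e e0.
  have [|g Cg] := H (Num.sqrt e); first by rewrite sqrtr_gt0.
  by rewrite ltr_sqrt//; exists g.
have [|g Cg ge] := H (e ^+ 2); first by rewrite exprn_gt0.
by exists g => //; rewrite -[e]ger0_norm ?ltW// -sqrtr_sqr ltr_sqrt// exprn_gt0.
Qed.

(** The support of [g] is closed in the union of two compact supports. Two functions are allowed in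
    order to cover midpoints. *)
Lemma Cc_support g h1 h2 : D g -> Cc E h1 -> Cc E h2 ->
  (forall x, h1 x = 0 -> h2 x = 0 -> g x = 0) -> Cc E g.
Proof.
move=> Dg [_ C1] [_ C2] gh; split; first exact: rf_dom_continuous.
apply: subclosed_compact (compactU C1 C2) _; first exact: closed_closure.
rewrite -closureU; apply: closureS => x /=.
have [h1x|] := eqVneq (h1 x) 0; last by left.
have [h2x|] := eqVneq (h2 x) 0; last by right.
by rewrite gh// eqxx.
Qed.

(** Inversion reverses the order on [0, +oo], including the infima 0 and [+oo], so a large
    resistance means a competitor of small energy. *)
Lemma lt_set_resistance (A B : set X) c : 0 < c ->
  (c^-1%:E < set_resistance A B)%E <->
  exists f, [/\ D f, (forall x, A x -> f x = 1), (forall x, B x -> f x = 0)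
              & EE f f < c].
Proof.
move=> c0; rewrite /set_resistance; set S := [set _ | _ in _].
have S0 : (0 <= ereal_inf S)%E.
  by apply: le_ereal_inf_tmp => _ [f [Df _ _] <-]; rewrite lee_fin rf_energy_ge0.
have -> : (c^-1%:E < (ereal_inf S)^-1)%E = (ereal_inf S < c%:E)%E.
  case: (ereal_inf S) S0 => [r|_|//]; last first.
    by rewrite invey lte_fin ltNge invr_ge0 ltW.
  rewrite lee_fin le_eqVlt inver => /predU1P[<-|r0].
    by rewrite eqxx ltry lte_fin c0.
  by rewrite gt_eqF// !lte_fin ltf_pV2.
split=> [/ereal_inf_lt[_ [f [Df fA fB] <-]]|[f [Df fA fB fc]]].
  by rewrite lte_fin; exists f.
by apply: (@le_lt_trans _ _ (EE f f)%:E) => //; apply: ereal_inf_lbound; exists f.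
Qed.

(** * The implications between the three statements *)

Lemma recurrent_dom1 x0 : recurrent E -> dom1 E x0 (cst 1).
Proof.
move=> [U [_ Uo _ [rho Urho]]]; apply/dom1P; split=> [|e e0].
  exact: rf_dom_cst.
pose r := resistance E rho x0.
have r1 : 0 < 1 + r by rewrite ltr_pwDl ?resistance_ge0.
(* Since f(rho) = 1, (1 - f(x0))^2 is at most r E(f), so [energy1] of 1 - f is at most (1 + r)
   E(f). *)
have c0 : 0 < e / (1 + r) by rewrite divr_gt0.
have /cvgeyPgt/(_ (e / (1 + r))^-1)[n _ /(_ n (leqnn n))] := Urho.
move=> /(lt_set_resistance _ _ c0)[f [Df frho fU fc]].
exists f.
  split=> //; split; first exact: rf_dom_continuous.
  have [_] := Uo n; rewrite precompactE => CU.
  apply: subclosed_compact CU _; first exact: closed_closure.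
  apply: closureS => x /= fx; apply: contrapT => /fU fx0.
  by rewrite fx0 eqxx in fx.
rewrite energy1_cst1//.
have := le_resistance rho x0 Df; rewrite frho// real_normK ?num_real// -/r.
move: fc; rewrite ltr_pdivlMr// => H1 H2; lra.
Qed.

Lemma dom1_recurrent x0 : dom1 E x0 (cst 1) -> recurrent E.
Proof.
move=> /dom1P[D1 H].
have /choice[h hP] n : exists h, [/\ Cc E h, D h &
    (* The factor 16 forces h(x0) > 3/4 and absorbs the square of the slope 4 used in the final
       cut. *)
    energy1 x0 (cst 1 \- h) (cst 1 \- h) < (16 * n.+1%:R)^-1].
  have [|h [Ch Dh] ?] := H (16 * n.+1%:R)^-1; last by exists h.
  by rewrite invr_gt0 mulr_gt0 ?ltr0n.
have Dh n : D (h n) by case: (hP n).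
have ch n : continuous (h n) by apply: rf_dom_continuous.
exists (fun n => \bigcup_(k in [set k | (k <= n)%N]) (h k @^-1` [set t | 2^-1 < t])).
split.
- move=> n x [k /= kn hx]; exists k => //=; exact: leqW.
- move=> n; split.
    apply: bigcup_open => k _; apply: open_comp; last exact: open_gt.
    by move=> x _; exact: ch.
  apply: (@precompact_subset _ _ (\big[setU/set0]_(k < n.+1)
      closure [set x | h k x != 0])); last first.
    apply: compact_precompact; first exact: metric_hausdorff.
    by apply: bigsetU_compact => k _; have [[]] := hP k.
  rewrite -(bigcup_mkord n.+1 (fun k => closure [set x | h k x != 0])) => x [k /= kn hx]; exists k => //=.
  apply: subset_closure => /=; apply: contraTneq hx => ->.
  by rewrite -leNgt invr_ge0.
- apply/seteqP; split=> // x _.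
  pose r := 1 + resistance E x x0.
  have r0 : 0 < r by rewrite ltr_pwDl ?resistance_ge0.
  (* As r < n + 1, the pointwise bound gives (1 - h_n(x))^2 < 2r / (16(n + 1)) < 1/4, so h_n(x) >
     1/2. *)
  pose n := Num.truncn r; exists n => //; exists n => //=.
  have [_ _ hn] := hP n.
  have := sqr_le_energy1 x0 x (rf_dom_sub D1 (Dh n)).
  have rn : r < n.+1%:R := truncnS_gt r.
  move: hn; rewrite -[(_ * _)^-1]div1r ltr_pdivlMr ?mulr_gt0 ?ltr0n//.
  set e := energy1 _ _ _ => en; rewrite -/r /= => hx.
  have e0 : 0 <= e := energy1_ge0 x0 (rf_dom_sub D1 (Dh n)).
  rewrite ltNge; apply/negP => hx2.
  have : 2^-1 ^+ 2 <= (1 - h n x) ^+ 2.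
    by rewrite ler_pXn2r ?nnegrE//; lra.
  have := ler_wpM2l e0 (ltW rn); lra.
exists x0; apply/cvgeyPgt => A.
near=> n.
have An : A <= n.+1%:R.
  have : (Num.truncn `|A| <= n)%N by near: n; exact: nbhs_infty_ge.
  rewrite -(ler_nat R) => nA; rewrite (le_trans (ler_norm A))//.
  by rewrite (le_trans (ltW (truncnS_gt _)))// -natr1 -[leRHS]natr1 lerD2r.
apply: (@le_lt_trans _ _ (n.+1%:R^-1^-1)%:E); first by rewrite lee_fin invrK.
apply/lt_set_resistance; first by rewrite invr_gt0 ltr0n.
(* The map 4s - 2 sends 1/2 to 0 and 3/4 to 1: the cut is 1 at [x0] and 0 off the n-th set. *)
have [Df Ef] := rf_markov (rf_dom_affine 4 (-2) (Dh n)).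
have [_ _] := hP n; rewrite energy1_cst1// invfM => hn.
have n1 : n.+1%:R^-1 <= 1 :> R by rewrite invf_le1 ?ltr0n// ler1n.
have e0 := rf_energy_ge0 (Dh n).
set v := n.+1%:R^-1 in hn n1 *.
eexists; split; first exact: Df.
- move=> _ ->; rewrite min_r ?max_l//.
  suff : 3 / 4 <= h n x0 by lra.
  rewrite leNgt; apply/negP => h34.
  have : (1 / 4) ^+ 2 <= (1 - h n x0) ^+ 2.
    by rewrite ler_pXn2r ?nnegrE//; lra.
  lra.
- move=> x Ux.
  have hx : h n x <= 2^-1.
    by rewrite leNgt; apply/negP => hx; apply: Ux; exists n => /=.
  rewrite min_l ?max_r//; lra.
- apply: (le_lt_trans Ef); rewrite rf_energy_affine//.
  have := sqr_ge0 (1 - h n x0); lra.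
Unshelve. all: by end_near. Qed.

Lemma rf_dom_bounded_ball x0 f n : D f ->
  exists2 M, 1 <= M & forall x, resistance E x x0 <= n -> `|f x| <= M.
Proof.
move=> Df; pose b := 2 * (1 + `|n|) * energy1 x0 f f.
have e0 := energy1_ge0 x0 Df.
exists (b + 1) => [|x xn]; first by rewrite lerDr mulr_ge0 ?e0 ?mulr_ge0 ?addr_ge0.
have : f x ^+ 2 <= b.
  apply: (le_trans (sqr_le_energy1 x0 x Df)).
  by rewrite ler_wpM2r// ler_wpM2l// lerD2l (le_trans xn)// ler_norm.
(* This amounts to 2|f(x)| <= f(x)^2 + 1. *)
have := sqr_ge0 (f x - 1); have := sqr_ge0 (f x + 1).
by rewrite ler_norml => ? ? ?; apply/andP; split; lra.
Qed.

Lemma dom1_cst_full x0 : dom1 E x0 (cst 1) -> D `<=` dom1 E x0.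
Proof.
move=> /dom1P[D1 H] f Df.
(* The ball grows while the tolerance shrinks, so the sets decrease and force pointwise convergence
   to [f]. *)
pose K (n : nat) := [set g | (Cc E `&` D) g /\
  forall x, resistance E x x0 <= n%:R -> `|g x - f x| <= n.+1%:R^-1].
have KE n : exists2 g, K n g & EE g g <= 36 * EE f f + 1.
  have [M M1 fM] := rf_dom_bounded_ball x0 n%:R Df.
  have M0 : 0 < M by exact: lt_le_trans M1.
  pose m : R := n.+1%:R; have m0 : 0 < m by rewrite ltr0n.
  have m1 : 1 <= m by rewrite ler1n.
  (* This makes 28 M^2 c = m^-3 <= 1 in the energy bound, and M^2 (2 m c) = m^-2 / 14 in the
     pointwise bound on the ball. *)
  pose c := (28 * M ^+ 2 * m ^+ 3)^-1.
  have c0 : 0 < c by rewrite invr_gt0 !mulr_gt0 ?exprn_gt0.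
  have [h0 [Ch0 Dh0] hc] := H _ c0.
  have [Dh Eh] := rf_markov Dh0.
  set h := (fun x => Num.max _ _) in Dh Eh.
  have h01 x : 0 <= h x <= 1.
    by rewrite le_max lexx orbT ge_max ge_min lexx orbT ler01.
  (* Truncating at [M] provides the boundedness required by [rf_dom_clamp] and leaves [f] unchanged
     on the ball. *)
  have [Dt Et] := rf_dom_trunc M0 Df; set t := (fun x => Num.max _ _) in Dt Et.
  have [|x|Dg Eg] := @rf_dom_clamp R F E t h M M Dt Dh M0.
  - move=> x; rewrite ler_norml le_max lexx orbT ge_max ge_min lexx orbT/=.
    lra.
  - by case/andP: (h01 x).
  set g := (fun x => Num.max _ _) in Dg Eg.
  have hx0 x : h0 x = 0 -> h x = 0 by move=> hx; rewrite /h hx min_l ?maxxx.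
  exists g; last first.
    apply: (le_trans Eg).
    have hc' : EE h h <= c.
      apply: (le_trans Eh); apply: le_trans (ltW hc).
      by rewrite energy1_cst1// lerDl sqr_ge0.
    have : 28 * M ^+ 2 * EE h h <= 1.
      have p0 : 0 < 28 * M ^+ 2 by rewrite mulr_gt0 ?exprn_gt0.
      apply: (le_trans (ler_wpM2l (ltW p0) hc')).
      rewrite /c invfM mulrA divff ?gt_eqF// mul1r invf_le1 ?exprn_gt0//.
      exact: exprn_ege1.
    lra.
  split.
    split=> //; apply: (@Cc_support g h0 h0) => // x /hx0 hx _.
    by rewrite /g hx mulr0 oppr0; case: (leP (t x) 0) => ?; rewrite ?maxxx// max_r.
  move=> x xn; have /fM := xn; rewrite ler_norml => /andP[fM1 fM2].
  have tx : t x = f x by rewrite /t min_l// max_l.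
  have : M * (1 - h x) <= m^-1.
    have : (1 - h x) ^+ 2 <= (1 - h0 x) ^+ 2.
      rewrite /h; case: (leP (h0 x) 1) => h1.
        by case: (leP (h0 x) 0) => h00; nra.
      by rewrite max_l// subrr expr0n/= sqr_ge0.
    have := sqr_le_energy1 x0 x (rf_dom_sub D1 Dh0); rewrite /= => H1 H2.
    have H3 : (1 - h x) ^+ 2 <= 2 * m * c.
      apply: (le_trans H2); apply: (le_trans H1).
      have e0 := energy1_ge0 x0 (rf_dom_sub D1 Dh0).
      have r0 := resistance_ge0 E x x0.
      have rm : 1 + resistance E x x0 <= m by rewrite /m -natr1 addrC lerD2r.
      apply: ler_pM => //; first by rewrite mulr_ge0 ?addr_ge0.
        by rewrite ler_wpM2l.
      exact: ltW.
    rewrite -(@ler_pXn2r _ 2)// ?nnegrE ?invr_ge0 ?(ltW m0)//; last first.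
      by rewrite mulr_ge0 ?(ltW M0)// subr_ge0; case/andP: (h01 x).
    rewrite exprMn; apply: (le_trans (ler_wpM2l (sqr_ge0 M) H3)).
    have -> : M ^+ 2 * (2 * m * c) = m^-1 ^+ 2 / 14.
      by rewrite /c; field; rewrite !gt_eqF.
    by rewrite ler_piMr ?sqr_ge0//; lra.
  rewrite -/m /g tx ler_norml => Mh; have /andP[h0x h1x] := h01 x.
  have := mulr_ge0 (ltW M0) h0x; have := ler_wpM2l (ltW M0) h1x.
  set p := M * h x; rewrite mulr1 => p1 p0.
  (* On the ball |f| <= M, so clamping at p >= M - 1/m moves [f] by at most 1/m. *)
  have : M - p <= m^-1 by move: Mh; rewrite mulrBr mulr1.
  have : 0 < m^-1 by rewrite invr_gt0.
  move: (m^-1) => v v0 Mpv; case: (leP (f x) p) => fp.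
    by case: (leP (f x) (- p)) => fp'; apply/andP; split; lra.
  by rewrite max_l; [apply/andP; split; lra | lra].
apply/dom1P; split=> // e e0.
have e2 : 0 < e / 2 by rewrite divr_gt0.
(* Then 1/(n + 1) is at most 1 and at most e/2, hence so is its square, which bounds the term of
   [energy1] at [x0]. *)
pose n := Num.truncn (e / 2 + 1 + (e / 2)^-1).
have := @rf_convex_approx R F E K _ f Df _ _ _ KE _ n _ e2.
case.
- by move=> k g [[]].
- move=> k l kl g [Cg gf]; split=> // x xk.
  apply: (@le_trans _ _ l.+1%:R^-1).
    by apply: gf; rewrite (le_trans xk)// ler_nat.
  by rewrite lef_pV2 ?posrE ?ltr0n// ler_nat.
- move=> k g1 g2 [[C1 Dg1] g1f] [[C2 Dg2] g2f]; split.
    split; last exact: rf_dom_mid.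
    apply: (Cc_support _ C1 C2) => [|x -> ->]; first exact: rf_dom_mid.
    by rewrite addr0 mul0r.
  move=> x xk; have := g1f x xk; have := g2f x xk.
  move: (_^-1) => v; rewrite !ler_norml => /andP[? ?] /andP[? ?].
  by apply/andP; split; lra.
(* The first entry puts [x] in the ball, the second makes the tolerance at most [d]. *)
- move=> x d d0; pose N := maxn (Num.truncn (resistance E x x0)).+1 (Num.truncn d^-1).
  exists N => g [_ /(_ x)]; have Nx : resistance E x x0 <= N%:R.
    by rewrite (le_trans (ltW (truncnS_gt _)))// ler_nat leq_maxl.
  move=> /(_ Nx) /le_trans; apply; rewrite invf_ple ?posrE ?ltr0n//.
  by rewrite (le_trans (ltW (truncnS_gt _)))// ler_nat ltnS leq_maxr.
move=> g [Cg gf] ge; exists g => //.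
rewrite /energy1 /= -expr2.
have : (f x0 - g x0) ^+ 2 <= e / 2.
  have := gf x0; rewrite resistancexx ler0n => /(_ isT) fg.
  have nn : (e / 2 + 1 + (e / 2)^-1) < n.+1%:R := truncnS_gt _.
  have v0 : 0 < (e / 2)^-1 by rewrite invr_gt0.
  have n0 : 0 < n.+1%:R :> R by rewrite ltr0n.
  have nv : n.+1%:R^-1 <= e / 2.
    by rewrite invf_ple ?posrE//; move: v0 nn; move: (_^-1) => v; lra.
  have n1 : n.+1%:R^-1 <= 1 :> R by rewrite invf_le1// ler1n.
  rewrite -real_normK ?num_real// distrC expr2.
  by rewrite -[e / 2]mulr1 ler_pM// (le_trans fg).
lra.
Qed.

End Topology.

Theorem theorem3p21 (R : realType) (F : Type) (E : resistance_form R F)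
    (x0 : F) :
  [<-> recurrent E;
       dom1 E x0 (cst 1);
       rf_dom E = dom1 E x0].
Proof.
tfae.
- exact: recurrent_dom1.
- move=> H; apply/seteqP; split; first exact: dom1_cst_full.
  by move=> f [].
- move=> H; apply: (@dom1_recurrent R F E x0); rewrite -H.
  exact: rf_dom_cst.
Qed.
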